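(* Let $\Bbbk$ be a field of characteristic zero, let $A_1,\dots,A_n$ be finite subsets of $\Bbbk$, let $\nu_i:A_i\to\mathbb{N}$ ($i=1,\dots,n$) be functions with positive integer values, and put $\mathbf{A}=A_1\times\cdots\times A_n$. Let $t_{\mathbf{a}}^{\mathbf{k}}\in\Bbbk$ be given for $\mathbf{a}\in\mathbf{A}$, $\mathbf{k}\in[\mathbf{0},\nu(\mathbf{a})-\mathbf{1}]$. Then the unique polynomial $f\in V(\mathbf{A},\nu)$ satisfying $\partial_{\mathbf{a}}^{\mathbf{m}}f=t_{\mathbf{a}}^{\mathbf{m}}$ for all $\mathbf{a}\in\mathbf{A}$ and $\mathbf{m}\in[\mathbf{0},\nu(\mathbf{a})-\mathbf{1}]$ is given by $$f(\mathbf{x})=\sum_{\mathbf{a}\in\mathbf{A}}\left(\Lambda_{\mathbf{a}}^{-1}T_{\mathbf{a}}\right)^{T}H_{\mathbf{a}}(\mathbf{x})=\sum_{\mathbf{a}\in\mathbf{A}}\left(\sum_{i=0}^{|\nu(\mathbf{a})|-1}\left(I_{|\nu(\mathbf{a})|}-\Lambda_{\mathbf{a}}\right)^{i}T_{\mathbf{a}}\right)^{T}H_{\mathbf{a}}(\mathbf{x}),$$ where $|\nu(\mathbf{a})|=\prod_{i=1}^n\nu_i(a_i)$, $I_{|\nu(\mathbf{a})|}$ is the identity matrix of that size, and the square matrix $\Lambda_{\mathbf{a}}$ and the column vectors $T_{\mathbf{a}}$, $H_{\mathbf{a}}$ are those defined in the context.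
   Context: For $\mathbf{a}=(a_1,\dots,a_n)\in\mathbf{A}$, $\nu(\mathbf{a}):=(\nu_1(a_1),\dots,\nu_n(a_n))$. $[\mathbf{0},\nu(\mathbf{a})-\mathbf{1}]$ is the set of $\mathbf{k}=(k_1,\dots,k_n)$ with integers $0\le k_i\le \nu_i(a_i)-1$ for all $i$; it has $|\nu(\mathbf{a})|$ elements. On $\mathbb{N}_0^n$, $\mathbf{k}\le\mathbf{m}$ means $k_i\le m_i$ for all $i$. $V(\mathbf{A},\nu)$ is the $\Bbbk$-vector space of all $f\in\Bbbk[x_1,\dots,x_n]$ with $\deg_i f<\sum_{a\in A_i}\nu_i(a)$ for $i=1,\dots,n$ ($\deg_i$ is the degree in $x_i$; the zero polynomial is included). $\partial_{\mathbf{a}}^{\mathbf{k}}f$ is the value at $\mathbf{x}=\mathbf{a}$ of $\frac{\partial^{k_1+\cdots+k_n}f}{\partial x_1^{k_1}\cdots\partial x_n^{k_n}}$. For $a_i\in A_i$ let $H_{a_i}(x_i):=\prod_{c\in A_i,\,c\ne a_i}\left(\frac{x_i-c}{a_i-c}\right)^{\nu_i(c)}\in\Bbbk[x_i]$, and for $\mathbf{a}\in\mathbf{A}$, $\mathbf{k}\in[\mathbf{0},\nu(\mathbf{a})-\mathbf{1}]$ let $$H_{(\mathbf{a},\mathbf{k})}(x_1,\dots,x_n):=\prod_{i=1}^n\frac{(x_i-a_i)^{k_i}H_{a_i}(x_i)}{k_i!}.$$ Degree reverse lexicographic order: $\mathbf{k}\prec\mathbf{l}$ if either $k_1+\cdots+k_n<l_1+\cdots+l_n$,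 or $k_1+\cdots+k_n=l_1+\cdots+l_n$ and $k_i>l_i$ for the largest $i$ with $k_i\ne l_i$. List the elements of $[\mathbf{0},\nu(\mathbf{a})-\mathbf{1}]$ in increasing order with respect to $\prec$ as $1_{\mathbf{a}}\prec 2_{\mathbf{a}}\prec\cdots\prec|\nu(\mathbf{a})|_{\mathbf{a}}$ (so $1_{\mathbf{a}}=\mathbf{0}$ and $|\nu(\mathbf{a})|_{\mathbf{a}}=\nu(\mathbf{a})-\mathbf{1}$). $\Lambda_{\mathbf{a}}$ is the $|\nu(\mathbf{a})|\times|\nu(\mathbf{a})|$ matrix whose entry in row $j$ and column $i$ equals $\partial_{\mathbf{a}}^{j_{\mathbf{a}}}H_{(\mathbf{a},i_{\mathbf{a}})}$ if $i_{\mathbf{a}}\le j_{\mathbf{a}}$ and equals $0$ otherwise (that is, if $j_{\mathbf{a}}<i_{\mathbf{a}}$ or $i_{\mathbf{a}},j_{\mathbf{a}}$ are incomparable for $\le$); it is lower triangular with all diagonal entries equal to $1$. $T_{\mathbf{a}}$ is the column vector with entries $t_{\mathbf{a}}^{1_{\mathbf{a}}},\dots,t_{\mathbf{a}}^{|\nu(\mathbf{a})|_{\mathbf{a}}}$, and $H_{\mathbf{a}}(\mathbf{x})$ is the column vector with entries $H_{(\mathbf{a},1_{\mathbf{a}})}(\mathbf{x}),\dots,H_{(\mathbf{a},|\nu(\mathbf{a})|_{\mathbf{a}})}(\mathbf{x})$. The superscript $T$ outside brackets denotes transpose, and $M^0$ is the identity matrix for every square matrix $M$. *)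

(* Defs.v *)
From HB Require Import structures.
From mathcomp Require Import all_boot all_order all_algebra.
From mathcomp Require Import finmap.
From mathcomp.multinomials Require Import mpoly.

Set Implicit Arguments.
Unset Strict Implicit.
Unset Printing Implicit Defensive.

Import GRing.Theory.
Local Open Scope ring_scope.

Definition grid (K : fieldType) (n : nat) (A : 'I_n -> {fset K}) : finType :=
  {dffun forall i : 'I_n, A i}.

Definition box (K : fieldType) (n : nat) (A : 'I_n -> {fset K})
    (nu : forall i : 'I_n, A i -> nat) (a : grid A) : finType :=
  {dffun forall i : 'I_n, 'I_(nu i (a i))}.

Definition nunorm (K : fieldType) (n : nat) (A : 'I_n -> {fset K})
    (nu : forall i : 'I_n, A i -> nat) (a : grid A) : nat :=
  (\prod_(i < n) nu i (a i))%N.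

Definition mnm_of_box (K : fieldType) (n : nat) (A : 'I_n -> {fset K})
    (nu : forall i : 'I_n, A i -> nat) (a : grid A) (k : box nu a) :
    'X_{1..n} :=
  [multinom (k i : nat) | i < n].

(* Degree reverse lexicographic order.  The canonical order [<=%O] of mpoly on
   monomials breaks ties at the smallest differing index, so it is not used. *)
Definition drl_lt (n : nat) (k l : 'X_{1..n}) : bool :=
  (mdeg k < mdeg l)%N ||
  (mdeg k == mdeg l) &&
    [exists i : 'I_n, (l i < k i)%N &&
      [forall j : 'I_n, (i < j)%N ==> (k j == l j)]].

Definition drl_le (n : nat) (k l : 'X_{1..n}) : bool := (k == l) || drl_lt k l.

Definition box_seq (K : fieldType) (n : nat) (A : 'I_n -> {fset K})
    (nu : forall i : 'I_n, A i -> nat) (a : grid A) : seq (box nu a) :=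
  sort (fun k l => drl_le (mnm_of_box k) (mnm_of_box l)) (enum (box nu a)).

Lemma size_box_seq (K : fieldType) (n : nat) (A : 'I_n -> {fset K})
    (nu : forall i : 'I_n, A i -> nat) (a : grid A) :
  size (box_seq nu a) == nunorm nu a.
Proof.
rewrite /box_seq size_sort -cardE card_dep_ffun /nunorm.
rewrite foldrE big_map big_enum /=.
by apply/eqP/eq_bigr => i _; rewrite card_ord.
Qed.

(* The listing 1_a < 2_a < ... < |nu(a)|_a, indexed from 0. *)
Definition box_tuple (K : fieldType) (n : nat) (A : 'I_n -> {fset K})
    (nu : forall i : 'I_n, A i -> nat) (a : grid A) :
    (nunorm nu a).-tuple (box nu a) :=
  Tuple (size_box_seq nu a).

Definition degi (K : fieldType) (n : nat) (i : 'I_n) (f : {mpoly K[n]}) : nat :=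
  \max_(m <- msupp f) m i.

(* The zero polynomial is a separate case because [degi i 0 = 0], while it has
   to belong to V even when [A i] is empty. *)
Definition inV (K : fieldType) (n : nat) (A : 'I_n -> {fset K})
    (nu : forall i : 'I_n, A i -> nat) (f : {mpoly K[n]}) : Prop :=
  f = 0 \/ forall i : 'I_n, (degi i f < \sum_(c : A i) nu i c)%N.

Definition pderiv_at (K : fieldType) (n : nat) (A : 'I_n -> {fset K})
    (a : grid A) (k : 'X_{1..n}) (f : {mpoly K[n]}) : K :=
  (f^`M[k]).@[fun i => val (a i)].

(* The univariate H_{a_i}(x_i), taken directly in K[x_1, ..., x_n]. *)
Definition Huni (K : fieldType) (n : nat) (A : 'I_n -> {fset K})
    (nu : forall i : 'I_n, A i -> nat) (i : 'I_n) (ai : A i) : {mpoly K[n]} :=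
  \prod_(c : A i | c != ai)
    ((val ai - val c)^-1 *: ('X_i - (val c)%:MP)) ^+ nu i c.

Definition Hpoly (K : fieldType) (n : nat) (A : 'I_n -> {fset K})
    (nu : forall i : 'I_n, A i -> nat) (a : grid A) (k : box nu a) :
    {mpoly K[n]} :=
  \prod_(i < n)
    (((k i)`!)%:R^-1 *: (('X_i - (val (a i))%:MP) ^+ k i * Huni nu (a i))).

Definition Lambda (K : fieldType) (n : nat) (A : 'I_n -> {fset K})
    (nu : forall i : 'I_n, A i -> nat) (a : grid A) : 'M[K]_(nunorm nu a) :=
  \matrix_(j, i)
    let kj := tnth (box_tuple nu a) j in
    let ki := tnth (box_tuple nu a) i in
    if (mnm_of_box ki <= mnm_of_box kj)%MM
    then pderiv_at a (mnm_of_box kj) (Hpoly ki) else 0.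

Definition Tvec (K : fieldType) (n : nat) (A : 'I_n -> {fset K})
    (nu : forall i : 'I_n, A i -> nat)
    (t : forall a : grid A, box nu a -> K) (a : grid A) :
    'cV[K]_(nunorm nu a) :=
  \col_j t a (tnth (box_tuple nu a) j).

Definition Hvec (K : fieldType) (n : nat) (A : 'I_n -> {fset K})
    (nu : forall i : 'I_n, A i -> nat) (a : grid A) :
    'cV[{mpoly K[n]}]_(nunorm nu a) :=
  \col_j Hpoly (tnth (box_tuple nu a) j).

(* [v^T *m h] for a vector of scalars and a vector of polynomials; the 1 x 1
   product is identified with its entry. *)
Definition dotH (K : fieldType) (n N : nat) (v : 'cV[K]_N)
    (h : 'cV[{mpoly K[n]}]_N) : {mpoly K[n]} :=
  (map_mx (@mpolyC n K) v^T *m h) 0 0.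

Definition hermite_interpolant (K : fieldType) (n : nat) (A : 'I_n -> {fset K})
    (nu : forall i : 'I_n, A i -> nat)
    (t : forall a : grid A, box nu a -> K) (f : {mpoly K[n]}) : Prop :=
  inV nu f /\
  forall (a : grid A) (m : box nu a), pderiv_at a (mnm_of_box m) f = t a m.

(* Main.v *)
(* For fixed [a], [H_(a,k)] is a product of univariate polynomials in separate
   variables, so its derivatives at the points of the grid factor.  They vanish
   at every node [b != a], because some factor is divisible by
   [(x_i - b_i) ^ nu_i(b_i)]; at [a] the derivative of order [m] vanishes unless
   [k <= m] and equals [1] for [m = k].  Hence [Lambda_a] is the full matrix of
   the derivatives of the [H_(a,k)] at [a], it is unitriangular because [<=] is
   compatible with the degree, and the system of interpolation conditions is
   block diagonal with blocks [Lambda_a].  The inverse is a finite geometric sum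
   because [1 - Lambda_a] is nilpotent.  Uniqueness: the evaluation map on [V]
   is onto, and [dim V = prod_i sum_c nu_i(c) = sum_a |nu(a)|]. *)

Require Import Defs.
From HB Require Import structures.
From mathcomp Require Import all_boot all_order all_algebra.
From mathcomp Require Import finmap.
From mathcomp.multinomials Require Import mpoly.

Set Implicit Arguments.
Unset Strict Implicit.
Unset Printing Implicit Defensive.

Import GRing.Theory.
Local Open Scope ring_scope.

(** * Derivatives at c of multiples of powers of X - c *)

Lemma deriv_XsubC_expM (R : comNzRingType) (c : R) k (q : {poly R}) :
  (('X - c%:P) ^+ k.+1 * q)^`() =
  ('X - c%:P) ^+ k * (q *+ k.+1 + ('X - c%:P) * q^`()).
Proof.
rewrite derivM deriv_exp /= derivXsubC mul1r mulrDr exprSr.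
by rewrite mulrnAl mulrnAr mulrA.
Qed.

Lemma derivn_XsubC_expM_root (R : comNzRingType) (c : R) k (q : {poly R}) m :
  (m < k)%N -> (('X - c%:P) ^+ k * q)^`(m).[c] = 0.
Proof.
elim: m k q => [|m IHm] [|k] q //= lt_mk.
  by rewrite hornerM horner_exp hornerXsubC subrr expr0n mul0r.
by rewrite -derivnS derivSn deriv_XsubC_expM IHm.
Qed.

(** By [deriv_XsubC_expM], differentiating lowers the exponent k+1 to k and multiplies the value of
    the cofactor at c by k+1; these numbers accumulate to k!. *)
Lemma derivn_XsubC_expM (R : comNzRingType) (c : R) k (q : {poly R}) :
  (('X - c%:P) ^+ k * q)^`(k).[c] = q.[c] *+ k`!.
Proof.
elim: k q => [|k IHk] q; first by rewrite mul1r.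
rewrite derivSn deriv_XsubC_expM IHk hornerD hornerMn hornerM.
by rewrite hornerXsubC subrr mul0r addr0 -mulrnA factS.
Qed.

(** * Products of univariate polynomials in separate variables *)

Section TensorPoly.
Variables (K : comNzRingType) (n : nat).
Implicit Type p : 'I_n -> {poly K}.

Definition poly_in (i : 'I_n) (q : {poly K}) : {mpoly K[n]} :=
  (map_poly (@mpolyC n K) q).['X_i].

Definition tensor p : {mpoly K[n]} := \prod_i poly_in i (p i).

Lemma poly_inE i (q : {poly K}) N : (size q <= N)%N ->
  poly_in i q = \sum_(j < N) q`_j *: 'X_i ^+ j.
Proof.
move=> le_qN; rewrite /poly_in.
rewrite (horner_coef_wide _ (leq_trans (size_poly _ _) le_qN)).
by apply: eq_bigr => j _; rewrite coef_map /= mul_mpolyC.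
Qed.

(** A common bound N on the sizes lets the product of sums expand over a single non-dependent
    function type. *)
Lemma tensorE p N : (forall i, size (p i) <= N)%N ->
  tensor p = \sum_(f : {ffun 'I_n -> 'I_N})
    (\prod_i (p i)`_(f i)) *: 'X_[[multinom (f i : nat) | i < n]].
Proof.
move=> le_pN; rewrite /tensor.
under eq_bigr do rewrite (poly_inE _ (le_pN _)).
rewrite bigA_distr_bigA; apply: eq_bigr => f _.
rewrite scaler_prod mpolyXE_id; congr (_ *: _).
by apply: eq_bigr => i _; rewrite mnmE.
Qed.

Lemma tensor_coef_neq0 p m i : (tensor p)@_m != 0 -> (m i < size (p i))%N.
Proof.
pose N := \max_i size (p i).
have le_pN j : (size (p j) <= N)%N by apply: leq_bigmax.
rewrite (tensorE le_pN) raddf_sum /= ltnNge; apply: contra => le_pm.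
apply/eqP/big1 => f _; rewrite mcoeffZ mcoeffX.
case: eqP => [Em | _]; last by rewrite mulr0.
rewrite (bigD1 i) //= nth_default ?mul0r //.
by move: le_pm; rewrite -Em mnmE.
Qed.

Lemma mderivm_monomial_eval (m k : 'X_{1..n}) (v : 'I_n -> K) :
  ('X_[m]^`M[k]).@[v] = \prod_i ('X^(m i))^`(k i).[v i] :> K.
Proof.
rewrite mderivmX mevalZ mevalX natr_prod -big_split /=.
apply: eq_bigr => i _.
by rewrite derivnXn hornerMn hornerXn mnmBE mulr_natl.
Qed.

(** Both sides are multilinear in the coefficients of the [p i], which reduces the claim to
    monomials. *)
Lemma tensor_mderivm_eval p (k : 'X_{1..n}) (v : 'I_n -> K) :
  ((tensor p)^`M[k]).@[v] = \prod_i (p i)^`(k i).[v i].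
Proof.
pose N := \max_i size (p i).
have le_pN j : (size (p j) <= N)%N by apply: leq_bigmax.
rewrite (tensorE le_pN) !raddf_sum /=.
have E i : (p i)^`(k i).[v i] = \sum_(j < N) (p i)`_j * ('X^j)^`(k i).[v i].
  have {1}->: p i = \sum_(j < N) (p i)`_j *: 'X^j.
    rewrite -poly_def; apply/polyP => j; rewrite coef_poly.
    by case: ltnP => // /(leq_trans (le_pN i)) le_pj; rewrite nth_default.
  rewrite raddf_sum horner_sum; apply: eq_bigr => j _ /=.
  by rewrite derivnZ hornerZ.
under [RHS]eq_bigr do rewrite E.
rewrite bigA_distr_bigA; apply: eq_bigr => f _.
rewrite mderivmZ mevalZ mderivm_monomial_eval big_split /=; congr (_ * _).
by apply: eq_bigr => i _; rewrite mnmE.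
Qed.

End TensorPoly.

(** * The univariate Hermite basis *)

Lemma size_prod_leS (R : nzSemiRingType) (I : finType) (P : pred I)
    (F : I -> {poly R}) (d : I -> nat) :
    (forall i, P i -> (size (F i) <= (d i).+1)%N) ->
  (size (\prod_(i | P i) F i)%R <= (\sum_(i | P i) d i).+1)%N.
Proof.
move=> le_Fd; elim/big_ind2: _ => [|p d1 q d2 le1 le2|//].
  by rewrite size_poly1.
apply: leq_trans (size_polyMleq _ _) _.
by rewrite -subn1 leq_subLR add1n -addnS -addSn leq_add.
Qed.

Section UnivariateHermite.
Variables (K : fieldType) (A : {fset K}) (nu : A -> nat).

Definition hermite_basis (a : A) (k : nat) : {poly K} :=
  (k`!)%:R^-1 *: (('X - (val a)%:P) ^+ k *
    \prod_(c : A | c != a) ((val a - val c)^-1 *: ('X - (val c)%:P)) ^+ nu c).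

(** The degree is at most k plus the sum of [nu c] over c != a, and k < [nu a] makes this smaller
    than the full sum. *)
Lemma size_hermite_basis a k : (k < nu a)%N ->
  (size (hermite_basis a k) <= \sum_c nu c)%N.
Proof.
move=> lt_k; apply: leq_trans (size_scale_leq _ _) _.
apply: leq_trans (size_polyMleq _ _) _.
rewrite size_exp_XsubC addSn addnC /=.
rewrite (bigD1 (P := predT) a) //= [leqRHS]addnC.
have le_prod : (size (\prod_(c : A | c != a)
    ((val a - val c)^-1 *: ('X - (val c)%:P)) ^+ nu c)%R
    <= (\sum_(c : A | c != a) nu c).+1)%N.
  apply: size_prod_leS => c _; apply: leq_trans (size_poly_exp_leq _ _) _.
  rewrite ltnS -[leqRHS]mul1n leq_mul2r -subn1 leq_subLR orbC.
  by rewrite (leq_trans (size_scale_leq _ _)) ?size_XsubC.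
apply: leq_trans (leq_add le_prod (leqnn k)) _.
by rewrite addSnnS leq_add2l.
Qed.

Lemma hermite_basis_derivn_neq a b k m : b != a -> (m < nu b)%N ->
  (hermite_basis a k)^`(m).[val b] = 0.
Proof.
move=> neq_ba lt_m; rewrite /hermite_basis (bigD1 b) //= exprZn -scalerAl.
rewrite -scalerAr !derivnZ !hornerZ [_ ^+ k * _]mulrCA.
by rewrite derivn_XsubC_expM_root ?mulr0.
Qed.

Lemma hermite_basis_derivn_lt a k m : (m < k)%N ->
  (hermite_basis a k)^`(m).[val a] = 0.
Proof.
by move=> lt_mk; rewrite derivnZ hornerZ derivn_XsubC_expM_root ?mulr0.
Qed.

Lemma hermite_basis_derivn_eq a k : [pchar K] =i pred0 ->
  (hermite_basis a k)^`(k).[val a] = 1.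
Proof.
move=> charK; rewrite derivnZ hornerZ derivn_XsubC_expM horner_prod big1.
  (* Characteristic zero enters here: k! has to be nonzero in K. *)
  by rewrite mulVf // ((pcharf0P K).1 charK) -lt0n fact_gt0.
move=> c neq_ca; rewrite horner_exp hornerZ hornerXsubC mulVf ?expr1n //.
by rewrite subr_eq0 (inj_eq val_inj) eq_sym.
Qed.

End UnivariateHermite.

(** * Inverses of unitriangular matrices *)

Lemma strict_trig_expr (R : pzRingType) N (M : 'M[R]_N) :
  (forall i j : 'I_N, (i <= j)%N -> M i j = 0) -> M ^+ N = 0.
Proof.
(* Each further factor M moves the support one diagonal down, so it has left the matrix after N
   steps. *)
move=> trM; suff H p (i j : 'I_N) : (i < j + p)%N -> (M ^+ p) i j = 0.
  by apply/matrixP=> i j; rewrite mxE H // (leq_trans (ltn_ord i)) ?leq_addl.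
elim: p i j => [|p IHp] i j.
  rewrite addn0 expr0 => lt_ij; rewrite mxE.
  by case: eqP lt_ij => // ->; rewrite ltnn.
move=> lt_ij; rewrite exprS mxE big1 // => l _.
have [/trM -> | lt_li] := leqP i l; first by rewrite mul0r.
by rewrite IHp ?mulr0 // (leq_trans lt_li) // -ltnS -addnS.
Qed.

Lemma unitrig_inv (R : comUnitRingType) N (L : 'M[R]_N) :
    (forall i j : 'I_N, (i < j)%N -> L i j = 0) -> (forall i, L i i = 1) ->
  L \in unitmx /\ invmx L = \sum_(0 <= i < N) (1%:M - L) ^+ i.
Proof.
move=> trL diagL; pose S := \sum_(0 <= i < N) (1%:M - L) ^+ i.
have LS1 : L *m S = 1%:M.
  have M0 : (1%:M - L) ^+ N = 0.
    apply: strict_trig_expr => i j.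
    rewrite leq_eqVlt => /orP[/eqP/val_inj->|lt_ij].
      by rewrite !mxE eqxx diagL subrr.
    by rewrite !mxE trL // -val_eqE /= ltn_eqF // subr0.
  (* With the N-th power gone, the telescoped geometric sum reads -1 = (1 - L - 1) S = -L S. *)
  have := subrX1 (1%:M - L) N; rewrite M0 sub0r.
  have -> : 1%:M - L - 1 = - L by rewrite addrAC subrr sub0r.
  by rewrite mulNr /S big_mkord => /oppr_inj/esym.
have [uL _] := mulmx1_unit LS1.
by split=> //; rewrite -[LHS]mulmx1 -[in LHS]LS1 mulKmx.
Qed.

(** * The degree reverse lexicographic order *)

Lemma drl_le_total n : total (@drl_le n).
Proof.
move=> k l; rewrite /drl_le /drl_lt [l == k]eq_sym [mdeg l == _]eq_sym.
case: eqVneq => //= neq_kl; case: ltngtP => //= _; apply/orP.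
have /existsP[i0 ne0] : [exists i : 'I_n, k i != l i].
  rewrite -negb_forall; apply: contra neq_kl => /forallP eq_kl.
  by apply/eqP/mnmP => i; apply/eqP.
(* The largest index at which k and l differ decides between monomials of equal degree. *)
have [i ne_i max_i] :=
  @arg_maxnP _ i0 (fun i => k i != l i) (fun i => i : nat) ne0.
have eq_gt (j : 'I_n) : (i < j)%N -> k j = l j.
  move=> lt_ij; apply/eqP/negPn; apply: contraL lt_ij => /max_i.
  by rewrite -leqNgt.
have [lt_kl|lt_lk|eq_kl] := ltngtP (k i) (l i);
  last by rewrite eq_kl eqxx in ne_i.
- right; apply/existsP; exists i; rewrite lt_kl; apply/forallP => j.
  by apply/implyP => /eq_gt->.
- left; apply/existsP; exists i; rewrite lt_lk; apply/forallP => j.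
  by apply/implyP => /eq_gt->.
Qed.

Lemma drl_le_mdeg n (k l : 'X_{1..n}) : drl_le k l -> (mdeg k <= mdeg l)%N.
Proof. by case/predU1P=> [->//|/orP[/ltnW//|/andP[/eqP->]]]. Qed.

(** The difference [l - k] has degree zero. *)
Lemma mnm_le_mdeg_eq n (k l : 'X_{1..n}) :
  (k <= l)%MM -> (mdeg l <= mdeg k)%N -> k = l.
Proof.
move=> le_kl; rewrite -{1}(submK le_kl) mdegD -{2}[mdeg k]add0n leq_add2r.
rewrite leqn0 mdeg_eq0 => /eqP lk0.
by rewrite -(submK le_kl) lk0 add0m.
Qed.

(** * The multivariate basis, the matrices [Lambda] and existence *)

Section MultivariateHermite.
Variables (K : fieldType) (n : nat) (A : 'I_n -> {fset K}).
Variable nu : forall i : 'I_n, A i -> nat.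
Arguments nu : clear implicits.

Lemma mnm_of_box_inj (a : grid A) : injective (@mnm_of_box K n A nu a).
Proof.
move=> k l /mnmP eq_kl; apply/ffunP => i; apply: val_inj.
by have := eq_kl i; rewrite !mnmE.
Qed.

Lemma box_tuple_uniq (a : grid A) : uniq (box_tuple nu a).
Proof. by rewrite sort_uniq enum_uniq. Qed.

Lemma mem_box_tuple (a : grid A) (k : box nu a) : k \in box_tuple nu a.
Proof. by rewrite mem_sort mem_enum. Qed.

Lemma box_tuple_mdeg (a : grid A) (i j : 'I_(nunorm nu a)) : (i < j)%N ->
  (mdeg (mnm_of_box (tnth (box_tuple nu a) i))
    <= mdeg (mnm_of_box (tnth (box_tuple nu a) j)))%N.
Proof.
move=> lt_ij; have k0 := tnth (box_tuple nu a) i; rewrite !(tnth_nth k0).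
pose le_mdeg (k l : box nu a) := (mdeg (mnm_of_box k) <= mdeg (mnm_of_box l))%N.
apply: (@sorted_ltn_nth _ le_mdeg) => //; rewrite ?inE ?size_tuple //.
  by move=> ? ? ?; apply: leq_trans.
(* Comparison of degrees is weaker than [drl_le], so the listing is sorted for it as well. *)
apply: (@sub_sorted _ (fun k l => drl_le (mnm_of_box k) (mnm_of_box l))).
  by move=> k l; apply: drl_le_mdeg.
by apply: sort_sorted => k l; apply: drl_le_total.
Qed.

Lemma Hpoly_tensor (a : grid A) (k : box nu a) :
  Hpoly k = tensor (fun i => hermite_basis (nu i) (a i) (k i)).
Proof.
apply: eq_bigr => i _; rewrite /poly_in /hermite_basis map_polyZ hornerZ.
rewrite mul_mpolyC; congr (_ *: _).
rewrite rmorphM hornerM rmorphXn horner_exp /= map_polyXsubC hornerXsubC.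
congr (_ * _); rewrite rmorph_prod horner_prod; apply: eq_bigr => c _.
rewrite rmorphXn horner_exp /= map_polyZ hornerZ map_polyXsubC hornerXsubC.
by rewrite mul_mpolyC.
Qed.

Lemma pderiv_at_Hpoly (a b : grid A) (k : box nu a) (m : 'X_{1..n}) :
  pderiv_at b m (Hpoly k) =
  \prod_i (hermite_basis (nu i) (a i) (k i))^`(m i).[val (b i)].
Proof. by rewrite /pderiv_at Hpoly_tensor tensor_mderivm_eval. Qed.

Lemma pderiv_at_Hpoly_neq (a b : grid A) (k : box nu a) (m : box nu b) :
  b != a -> pderiv_at b (mnm_of_box m) (Hpoly k) = 0.
Proof.
move=> neq_ba; have /existsP[i ne_i] : [exists i, b i != a i].
  rewrite -negb_forall; apply: contra neq_ba => /forallP eq_ba.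
  by apply/eqP/ffunP => i; apply/eqP.
by rewrite pderiv_at_Hpoly (bigD1 i) //= mnmE hermite_basis_derivn_neq ?mul0r.
Qed.

Lemma pderiv_at_Hpoly_nle (a : grid A) (k m : box nu a) :
  ~~ (mnm_of_box k <= mnm_of_box m)%MM ->
  pderiv_at a (mnm_of_box m) (Hpoly k) = 0.
Proof.
rewrite negb_forall => /existsP[i]; rewrite !mnmE -ltnNge => lt_mk.
by rewrite pderiv_at_Hpoly (bigD1 i) //= mnmE hermite_basis_derivn_lt ?mul0r.
Qed.

Lemma pderiv_at_Hpoly_eq (a : grid A) (k : box nu a) : [pchar K] =i pred0 ->
  pderiv_at a (mnm_of_box k) (Hpoly k) = 1.
Proof.
move=> charK; rewrite pderiv_at_Hpoly big1 // => i _.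
by rewrite mnmE hermite_basis_derivn_eq.
Qed.

Lemma LambdaE (a : grid A) j i :
  Lambda nu a j i = pderiv_at a (mnm_of_box (tnth (box_tuple nu a) j))
                      (Hpoly (tnth (box_tuple nu a) i)).
Proof.
by rewrite mxE /=; case: ifPn => // nle_ij; rewrite pderiv_at_Hpoly_nle.
Qed.

(** A nonzero entry above the diagonal would need ki <= kj with ki later in the listing, hence of
    degree at least that of kj; the two would coincide, but the listing has no repetitions. *)
Lemma Lambda_trig (a : grid A) (j i : 'I_(nunorm nu a)) :
  (j < i)%N -> Lambda nu a j i = 0.
Proof.
move=> lt_ji; rewrite mxE /=; case: ifP => // le_ij.
have /mnm_of_box_inj/(tuple_uniqP _ (box_tuple_uniq a)) eq_ij :=
  mnm_le_mdeg_eq le_ij (box_tuple_mdeg lt_ji).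
by rewrite eq_ij ltnn in lt_ji.
Qed.

Lemma Lambda_diag (a : grid A) i : [pchar K] =i pred0 -> Lambda nu a i i = 1.
Proof. by move=> charK; rewrite LambdaE pderiv_at_Hpoly_eq. Qed.

(** The condition on the support is vacuous for the zero polynomial, so it absorbs the separate case
    of [inV]. *)
Lemma inVP (f : {mpoly K[n]}) :
  inV nu f <-> forall m i, m \in msupp f -> (m i < \sum_(c : A i) nu i c)%N.
Proof.
split=> [[->|lt_f] m i f_m | lt_f]; first by rewrite msupp0 in f_m.
  by apply: leq_ltn_trans (lt_f i); rewrite /degi (big_rem m) //= leq_maxl.
have [->|nz_f] := eqVneq f 0; [by left|right=> i].
rewrite /degi big_seq; elim/big_ind: _ => [|x y lt_x lt_y|m /lt_f//].
  (* The maximum starts from 0, so the bound must be positive; the leading monomial of f witnesses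
     this. *)
  exact: leq_ltn_trans (lt_f _ i (mlead_supp nz_f)).
by rewrite gtn_max lt_x.
Qed.

Lemma dotHE N (v : 'cV[K]_N) (h : 'cV[{mpoly K[n]}]_N) :
  dotH v h = \sum_j v j 0 *: h j 0.
Proof.
by rewrite /dotH mxE; apply: eq_bigr => j _; rewrite !mxE mul_mpolyC.
Qed.

Definition hermite_sum (t : forall a : grid A, box nu a -> K) : {mpoly K[n]} :=
  \sum_(a : grid A) dotH (invmx (Lambda nu a) *m Tvec t a) (Hvec nu a).

Lemma hermite_sum_inV t : inV nu (hermite_sum t).
Proof.
apply/inVP => m i; rewrite mcoeff_msupp; apply: contraNltn => le_m.
rewrite raddf_sum big1 //= => a _; rewrite dotHE raddf_sum big1 //= => j _.
rewrite mcoeffZ [Hvec _ _ _ _]mxE Hpoly_tensor.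
apply/eqP; rewrite mulf_eq0; apply/orP; right.
apply: contraLR le_m => /(tensor_coef_neq0 i) lt_m; rewrite -ltnNge.
by apply: leq_trans lt_m _; apply: size_hermite_basis.
Qed.

Lemma pderiv_at_hermite_sum t (b : grid A) (m : box nu b) :
  Lambda nu b \in unitmx -> pderiv_at b (mnm_of_box m) (hermite_sum t) = t b m.
Proof.
move=> uL; have pderiv_dotH (a : grid A) (v : 'cV[K]_(nunorm nu a)) :
    pderiv_at b (mnm_of_box m) (dotH v (Hvec nu a)) =
    \sum_j v j 0 *
      pderiv_at b (mnm_of_box m) (Hpoly (tnth (box_tuple nu a) j)).
  rewrite dotHE /pderiv_at !raddf_sum; apply: eq_bigr => j _ /=.
  by rewrite mderivmZ mevalZ [Hvec _ _ _ _]mxE.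
rewrite /hermite_sum /pderiv_at !raddf_sum /= (bigD1 b) //=.
rewrite [X in _ + X]big1; last first.
  move=> a neq_ab; rewrite -/(pderiv_at _ _ _) pderiv_dotH big1 // => j _.
  by rewrite pderiv_at_Hpoly_neq ?mulr0 // eq_sym.
rewrite addr0 -/(pderiv_at _ _ _) pderiv_dotH.
have /tnthP[j ->] := mem_box_tuple m.
(* Only the block of b is left, and there the system is [Lambda] applied to its own solution. *)
transitivity ((Lambda nu b *m (invmx (Lambda nu b) *m Tvec t b)) j 0).
  by rewrite [RHS]mxE; apply: eq_bigr => i _; rewrite LambdaE mulrC.
by rewrite mulKVmx // mxE.
Qed.

(** * Uniqueness by counting dimensions *)

Definition monomial_box : finType :=
  {dffun forall i, 'I_(\sum_(c : A i) nu i c)}.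

Definition mnm_of_monomial_box (b : monomial_box) : 'X_{1..n} :=
  [multinom (b i : nat) | i < n].

Lemma mnm_of_monomial_box_inj : injective mnm_of_monomial_box.
Proof.
move=> k l /mnmP eq_kl; apply/ffunP => i; apply: val_inj.
by have := eq_kl i; rewrite !mnmE.
Qed.

Lemma inV_expand (f : {mpoly K[n]}) : inV nu f ->
  f = \sum_(b : monomial_box)
        f@_(mnm_of_monomial_box b) *: 'X_[mnm_of_monomial_box b].
Proof.
move=> /inVP Vf; apply/mpolyP => m; rewrite raddf_sum /=.
have term b : (f@_(mnm_of_monomial_box b) *: 'X_[mnm_of_monomial_box b])@_m
    = f@_m *+ (mnm_of_monomial_box b == m).
  by rewrite mcoeffZ mcoeffX mulr_natr; case: eqP => [->|].
under eq_bigr do rewrite term.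
have [f_m | /memN_msupp_eq0 ->] := boolP (m \in msupp f); last first.
  by rewrite big1 // => b _; rewrite mul0rn.
pose b0 : monomial_box := [ffun i => Ordinal (Vf m i f_m)].
have b0E : mnm_of_monomial_box b0 = m.
  by apply/mnmP => i; rewrite mnmE ffunE.
rewrite (bigD1 b0) //= b0E eqxx big1 ?addr0 // => b.
by rewrite -(inj_eq mnm_of_monomial_box_inj) b0E => /negPf->.
Qed.

(** Indexes the interpolation conditions, the rows of the linear system whose columns are indexed by
    [monomial_box]. *)
Definition hermite_node : finType := {a : grid A & box nu a}.

(* A node with its derivative order is the same thing as a choice, for every
   coordinate [i], of a point of [A i] together with an order at that point. *)
Lemma card_monomial_box_le : (#|monomial_box| <= #|hermite_node|)%N.
Proof.
pose D : finType := {dffun forall i, {c : A i & 'I_(nu i c)}}.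
have -> : #|monomial_box| = #|D|.
  rewrite !card_dep_ffun !foldrE !big_map; apply: eq_bigr => i _.
  rewrite card_tagged card_ord sumnE big_map big_enum.
  by apply: eq_bigr => c _; rewrite card_ord.
pose join (s : hermite_node) : D :=
  [ffun i => Tagged (fun c => 'I_(nu i c)) (tagged s i)].
pose pts (w : D) : grid A := [ffun i => tag (w i)].
have ptsE (w : D) i : tag (w i) = pts w i by rewrite ffunE.
(* The type of the order depends on the point, so the order is transported along [ptsE]. *)
pose ords (w : D) : box nu (pts w) :=
  [ffun i => etagged (ptsE w i)].
pose split (w : D) : hermite_node := Tagged (fun a => box nu a) (ords w).
suff /can_inj/leq_card : cancel split join by [].
move=> w; apply/ffunP => i.
have ordsE : ords w i = etagged (ptsE w i) by exact: ffunE.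
by rewrite ffunE /= ordsE etaggedK.
Qed.

(** Solvability for all data gives the matrix M of the conditions on monomials a right inverse, so
    its rank is the number of conditions, which is at least its number of columns; hence M is
    injective on coefficient vectors. *)
Lemma inV_eq0 (f : {mpoly K[n]}) : [pchar K] =i pred0 -> inV nu f ->
  (forall (a : grid A) (m : box nu a), pderiv_at a (mnm_of_box m) f = 0) ->
  f = 0.
Proof.
move=> charK Vf f0.
pose M := \matrix_(s < #|hermite_node|, b < #|monomial_box|)
  pderiv_at (tag (enum_val s)) (mnm_of_box (tagged (enum_val s)))
    'X_[mnm_of_monomial_box (enum_val b)].
pose coefs (g : {mpoly K[n]}) :=
  \col_(b < #|monomial_box|) g@_(mnm_of_monomial_box (enum_val b)).
have M_coefs g s : inV nu g -> (M *m coefs g) s 0 =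
    pderiv_at (tag (enum_val s)) (mnm_of_box (tagged (enum_val s))) g.
  move=> /inV_expand {2}->; rewrite /pderiv_at !raddf_sum /= big_enum_val mxE.
  by apply: eq_bigr => b _; rewrite !mxE mderivmZ mevalZ mulrC.
have full_M : row_full M.
  (* Kronecker delta data: 1 for the condition s, 0 for all others. The coefficients of the
     resulting interpolants form the columns of the right inverse. *)
  pose t (s : 'I_#|hermite_node|) (a : grid A) (m : box nu a) : K :=
    (Tagged (fun a => box nu a) m == enum_val s)%:R.
  pose B := \matrix_(b < #|monomial_box|, s < #|hermite_node|)
    coefs (hermite_sum (t s)) b 0.
  have /row_freeP/eqP rkM : exists B, M *m B = 1%:M.
    exists B; apply/matrixP => s s'; rewrite !mxE.
    have := M_coefs _ s (hermite_sum_inV (t s')).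
    rewrite pderiv_at_hermite_sum; last first.
      have [] // := unitrig_inv (@Lambda_trig (tag (enum_val s))).
      by move=> i; apply: Lambda_diag.
    rewrite /t taggedK (inj_eq enum_val_inj) => <-.
    by rewrite !mxE; apply: eq_bigr => b _; rewrite !mxE.
  by rewrite /row_full eqn_leq rank_leq_col rkM card_monomial_box_le.
rewrite (inV_expand Vf) big_enum_val big1 //= => b _.
have coefs0 : coefs f = 0.
  apply: (row_full_inj full_M); rewrite mulmx0; apply/colP => s.
  by rewrite M_coefs // f0 mxE.
by move/colP/(_ b): coefs0; rewrite !mxE => ->; rewrite scale0r.
Qed.

End MultivariateHermite.

Theorem theorem2p5 (K : fieldType) (charK : [pchar K] =i pred0)
    (n : nat) (A : 'I_n -> {fset K})
    (nu : forall i : 'I_n, A i -> nat)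
    (nu_gt0 : forall (i : 'I_n) (c : A i), (0 < nu i c)%N)
    (t : forall a : grid A, box nu a -> K) :
  (forall a : grid A, Lambda nu a \in unitmx) /\
  exists f : {mpoly K[n]},
    [/\ unique (hermite_interpolant t) f,
        f = \sum_(a : grid A) dotH (invmx (Lambda nu a) *m Tvec t a) (Hvec nu a)
      & f = \sum_(a : grid A)
              dotH ((\sum_(0 <= i < nunorm nu a) (1%:M - Lambda nu a) ^+ i)
                      *m Tvec t a) (Hvec nu a)].
Proof.
have LambdaP (a : grid A) := unitrig_inv (@Lambda_trig _ _ _ nu a)
  (fun i => Lambda_diag i charK).
have uL a : Lambda nu a \in unitmx by case: (LambdaP a).
split=> //; exists (hermite_sum t); split=> //; last first.
  by apply: eq_bigr => a _; rewrite (LambdaP a).2.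
split=> [|g [Vg gE]].
  split=> [|a m]; first exact: hermite_sum_inV.
  exact: pderiv_at_hermite_sum.
(* The difference of two interpolants lies in V, and all its prescribed derivatives vanish. *)
apply/eqP; rewrite -subr_eq0; apply/eqP/(@inV_eq0 _ _ _ nu) => // [|a m].
  apply/inVP => m i /msuppB_le; rewrite mem_cat => /orP[] m_supp.
    by have /inVP := hermite_sum_inV t; apply.
  by have /inVP := Vg; apply.
by rewrite /pderiv_at mderivmB mevalB -!/(pderiv_at _ _ _) gE
  pderiv_at_hermite_sum ?subrr.
Qed.
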